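(* Let $T=(\mathcal{L},\mathcal{R})$ be a graph transformation system and $D\subseteq\mathcal{G}(\mathcal{L})$. If all non-garbage critical pairs of $T$ with respect to $D$ are strongly joinable, then $T$ is locally confluent modulo garbage with respect to $D$.
   Context: Fix a label alphabet $\mathcal{L}=(\mathcal{L}_V,\mathcal{L}_E)$ of finite sets. A graph is $G=(V,E,s,t,l,m)$ with finite $V,E$, total $s,t$, total labellings; morphisms preserve sources, targets, labels. A rule $r=\langle L\leftarrow K\rightarrow R\rangle$: graphs with $K$ a subgraph of $L$ and of $R$. A direct derivation $G\Rightarrow_{r,g}H$ uses an injective $g:L\to G$ satisfying the dangling condition (no edge outside $g(L)$ incident to $g(V_L\setminus V_K)$): the intermediate graph $D_0=G\setminus g(L\setminus K)$ with inclusion $in:D_0\to G$, and $H$ obtained by gluing $R$ to $D_0$ along $K$ with morphism $in':D_0\to H$ (double pushout). The track morphism of $G\Rightarrow H$ is the partial morphism $tr_{G\Rightarrow H}=in'\circ in^{-1}$; for a derivation sequence it is the composition of the track morphisms of its steps. GT system: finite rule set; $\mathcal{G}(\mathcal{L})$: isomorphism classes of graphs. $H_1\Leftarrow_{r_1,g_1}G\Rightarrow_{r_2,g_2}H_2$ parallelly independent iff $g_1(L_1)\cap g_2(L_2)\subseteq g_1(K_1)\cap g_2(K_2)$; a critical pair iff $G=g_1(L_1)\cup g_2(L_2)$, not parallelly independent, and $g_1\ne g_2$ if $r_1=r_2$. Persistent nodes of a critical pair $\Phi:H_1\Leftarrow G\Rightarrow H_2$: $Persist_\Phi=\{v\in V_G\mid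 tr_{G\Rightarrow H_1}(\{v\})\ne\emptyset\ne tr_{G\Rightarrow H_2}(\{v\})\}$. $\Phi$ is strongly joinable iff there are a graph $M$ and derivations $H_1\Rightarrow^*_{\mathcal{R}}M\Leftarrow^*_{\mathcal{R}}H_2$ with $tr_{G\Rightarrow H_1\Rightarrow^*M}(\{v\})=tr_{G\Rightarrow H_2\Rightarrow^*M}(\{v\})\ne\emptyset$ for all $v\in Persist_\Phi$. $D$ subgraph closed iff closed under taking subgraphs; $\overline{D}$ the smallest subgraph-closed superset of $D$; a critical pair is non-garbage iff $[G]\in\overline{D}$. Joinable: $\exists M$, $H_1\Rightarrow^*M\Leftarrow^*H_2$. $T$ locally confluent modulo garbage w.r.t. $D$ iff for all $G$ with $[G]\in D$, $H_1\Leftarrow_{\mathcal{R}}G\Rightarrow_{\mathcal{R}}H_2$ implies $H_1,H_2$ joinable. *)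

(* Defs.v *)
From Stdlib Require List.
From mathcomp Require Import all_boot.

Set Implicit Arguments.
Unset Strict Implicit.
Unset Printing Implicit Defensive.

Record alphabet := Alphabet { node_label : finType; edge_label : finType }.

Record graph (L : alphabet) := Graph {
  V : finType;
  E : finType;
  src : E -> V;
  tgt : E -> V;
  vlab : V -> node_label L;
  elab : E -> edge_label L }.

Arguments Graph {L V E}.

Section Morphisms.
Variable L : alphabet.
Implicit Types G H : graph L.

Record morph G H := Morph {
  vmap : V G -> V H;
  emap : E G -> E H;
  morph_src : forall e, src (emap e) = vmap (src e);
  morph_tgt : forall e, tgt (emap e) = vmap (tgt e);
  morph_vlab : forall v, vlab (vmap v) = vlab v;
  morph_elab : forall e, elab (emap e) = elab e }.

Definition morph_eq G H (f g : morph G H) : Prop :=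
  vmap f =1 vmap g /\ emap f =1 emap g.

Definition morph_comp G H I (g : morph H I) (f : morph G H) : morph G I.
Proof.
exists (vmap g \o vmap f) (emap g \o emap f) => x /=.
- by rewrite !morph_src.
- by rewrite !morph_tgt.
- by rewrite !morph_vlab.
- by rewrite !morph_elab.
Defined.

Definition morph_inj G H (f : morph G H) : Prop :=
  injective (vmap f) /\ injective (emap f).

Definition morph_iso G H (f : morph G H) : Prop :=
  bijective (vmap f) /\ bijective (emap f).

Definition isomorphic G H : Prop := exists f : morph G H, morph_iso f.

Definition pushout A B C P (f : morph A B) (g : morph A C)
    (p : morph B P) (q : morph C P) : Prop :=
  morph_eq (morph_comp p f) (morph_comp q g) /\
  forall X (u : morph B X) (v : morph C X),
    morph_eq (morph_comp u f) (morph_comp v g) ->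
    exists w : morph P X,
      (morph_eq (morph_comp w p) u /\ morph_eq (morph_comp w q) v) /\
      forall w' : morph P X,
        morph_eq (morph_comp w' p) u /\ morph_eq (morph_comp w' q) v ->
        morph_eq w' w.

Record subgraph G := Subgraph {
  subV : {set V G};
  subE : {set E G};
  sub_src : forall e, e \in subE -> src e \in subV;
  sub_tgt : forall e, e \in subE -> tgt e \in subV }.

Definition graph_of_sub G (S : subgraph G) : graph L :=
  @Graph L {v : V G | v \in subV S} {e : E G | e \in subE S}
    (fun e => exist _ (src (val e)) (sub_src (valP e)))
    (fun e => exist _ (tgt (val e)) (sub_tgt (valP e)))
    (fun v => vlab (val v))
    (fun e => elab (val e)).

Definition incl G (S : subgraph G) : morph (graph_of_sub S) G :=
  @Morph (graph_of_sub S) G val val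
    (fun=> erefl) (fun=> erefl) (fun=> erefl) (fun=> erefl).

(* The graphs K, L and R of a rule have distinct carrier types, so the two
   subgraph inclusions K -> L and K -> R are injective morphisms. *)
Record rule := Rule {
  lhs : graph L;
  interface : graph L;
  rhs : graph L;
  to_lhs : morph interface lhs;
  to_rhs : morph interface rhs;
  to_lhs_inj : morph_inj to_lhs;
  to_rhs_inj : morph_inj to_rhs }.

(* g(V_L \ V_K) and g(E_L \ E_K) *)
Definition deletedV r G (g : morph (lhs r) G) : {set V G} :=
  vmap g @: (~: (vmap (to_lhs r) @: setT)).

Definition deletedE r G (g : morph (lhs r) G) : {set E G} :=
  emap g @: (~: (emap (to_lhs r) @: setT)).

Definition dangling_condition r G (g : morph (lhs r) G) : Prop :=
  forall e : E G, e \notin emap g @: setT ->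
    src e \notin deletedV g /\ tgt e \notin deletedV g.

Record rule_match r G := RuleMatch {
  match_morph :> morph (lhs r) G;
  match_inj : morph_inj match_morph;
  match_dangling : dangling_condition match_morph }.

Lemma context_closed r G (g : rule_match r G) (e : E G) :
  e \in ~: deletedE g ->
  src e \in ~: deletedV g /\ tgt e \in ~: deletedV g.
Proof.
rewrite inE => eND.
have [/imsetP[x _ ex]|eNg] := boolP (e \in emap g @: setT); last first.
  by have [? ?] := match_dangling eNg; rewrite !inE.
have [y yx] : exists y, x = emap (to_lhs r) y.
  have [/imsetP[y _ ->]|xN] := boolP (x \in emap (to_lhs r) @: setT).
    by exists y.
  by case/negP: eND; rewrite ex; apply: imset_f; rewrite inE.
have keep z : vmap g (vmap (to_lhs r) z) \in ~: deletedV g.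
  rewrite inE; apply/imsetP => -[w]; rewrite inE => /negP wN.
  by move=> /(match_inj g).1 zw; apply: wN; rewrite -zw imset_f.
by rewrite ex yx !morph_src !morph_tgt; split; apply: keep.
Qed.

(* The intermediate graph G \ g(L \ K). *)
Definition context r G (g : rule_match r G) : subgraph G :=
  @Subgraph G (~: deletedV g) (~: deletedE g)
    (fun e eC => (context_closed eC).1) (fun e eC => (context_closed eC).2).

(* The right-hand pushout determines the result only up to isomorphism. The
   morphism K -> context is forced: it is the restriction of the match. *)
Record direct_derivation r G H := DirectDerivation {
  dd_match : rule_match r G;
  dd_interface : morph (interface r) (graph_of_sub (context dd_match));
  dd_in' : morph (graph_of_sub (context dd_match)) H;
  dd_comatch : morph (rhs r) H;
  dd_restr : morph_eq (morph_comp (incl (context dd_match)) dd_interface)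
                      (morph_comp dd_match (to_lhs r));
  dd_gluing : pushout (to_rhs r) dd_interface dd_comatch dd_in' }.

(* The node part of the track morphism in' o in^-1, acting on sets of nodes:
   an undefined value tr(v) is the empty image of the singleton {v}. *)
Definition track r G H (d : direct_derivation r G H) (A : {set V G}) :
    {set V H} :=
  vmap (dd_in' d) @: (vmap (incl (context (dd_match d))) @^-1: A).

(* A finite set of rules is given by a list; only membership is used. *)
Implicit Type rules : seq rule.

(* G =>* H; a derivation of length zero is an isomorphism. *)
Inductive derivation rules : graph L -> graph L -> Type :=
| DerivIso G H (f : morph G H) of morph_iso f : derivation rules G H
| DerivStep G H M r of List.In r rules & direct_derivation r G H
    & derivation rules H M : derivation rules G M.

Fixpoint derivation_track rules G H (d : derivation rules G H) :
    {set V G} -> {set V H} :=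
  match d in derivation _ G H return {set V G} -> {set V H} with
  | DerivIso _ _ f _ => fun A => vmap f @: A
  | DerivStep _ _ _ _ _ d1 ds => fun A => derivation_track ds (track d1 A)
  end.

Definition joinable rules H1 H2 : Prop :=
  exists M, inhabited (derivation rules H1 M) /\
            inhabited (derivation rules H2 M).

Section Pairs.
Variables (r1 r2 : rule) (G H1 H2 : graph L).
Variables (d1 : direct_derivation r1 G H1) (d2 : direct_derivation r2 G H2).
Let g1 := dd_match d1.
Let g2 := dd_match d2.

Definition parallelly_independent : Prop :=
  (vmap g1 @: setT) :&: (vmap g2 @: setT) \subset
    (vmap (morph_comp g1 (to_lhs r1)) @: setT) :&:
    (vmap (morph_comp g2 (to_lhs r2)) @: setT) /\
  (emap g1 @: setT) :&: (emap g2 @: setT) \subset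
    (emap (morph_comp g1 (to_lhs r1)) @: setT) :&:
    (emap (morph_comp g2 (to_lhs r2)) @: setT).

Definition critical_pair : Prop :=
  [/\ (vmap g1 @: setT) :|: (vmap g2 @: setT) = setT,
      (emap g1 @: setT) :|: (emap g2 @: setT) = setT,
      ~ parallelly_independent
    & forall r12 : r1 = r2,
        ~ morph_eq (ecast r (morph (lhs r) G) r12 (match_morph g1)) g2].

Definition persistent : {set V G} :=
  [set v | (track d1 [set v] != set0) && (track d2 [set v] != set0)].

Definition strongly_joinable rules : Prop :=
  exists M (ds1 : derivation rules H1 M) (ds2 : derivation rules H2 M),
    forall v, v \in persistent ->
      derivation_track ds1 (track d1 [set v]) =
        derivation_track ds2 (track d2 [set v]) /\
      derivation_track ds1 (track d1 [set v]) != set0.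

End Pairs.

(* Sets of graphs, and sets of isomorphism classes, are plain predicates: the
   carrier universe of graph is too large for mathcomp's classical sets. *)
Definition graph_class := {C : graph L -> Prop | exists G, C = isomorphic G}.

Definition class_of G : graph_class :=
  exist _ (isomorphic G) (ex_intro _ G erefl).

Definition subgraph_closed (D : graph_class -> Prop) : Prop :=
  forall G (S : subgraph G), D (class_of G) -> D (class_of (graph_of_sub S)).

Definition subgraph_closure (D : graph_class -> Prop) (c : graph_class) : Prop :=
  forall D' : graph_class -> Prop,
    subgraph_closed D' -> (forall c', D c' -> D' c') -> D' c.

Definition non_garbage (D : graph_class -> Prop) G : Prop :=
  subgraph_closure D (class_of G).

Definition locally_confluent_modulo_garbage rules
    (D : graph_class -> Prop) : Prop :=
  forall G, D (class_of G) ->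
  forall H1 H2 r1 r2, List.In r1 rules -> List.In r2 rules ->
    direct_derivation r1 G H1 -> direct_derivation r2 G H2 ->
    joinable rules H1 H2.

End Morphisms.

(* Main.v *)
Require Import Defs.
From mathcomp Require Import all_boot.
From Stdlib Require List.
From Stdlib Require Import Classical FunctionalExtensionality.

Set Implicit Arguments.
Unset Strict Implicit.
Unset Printing Implicit Defensive.

(** If the two steps are parallelly independent, write [G] as the gluing of
  [L1] to the context [D1] of the first step along [K1]. The second step already
  takes place inside [D1], as [D1 => D1'] say, and gluing [L1], respectively
  [R1], back along [K1] turns it into steps from [G] and from [H1]; the results
  differ only by an application of the first rule.
  Otherwise, unless the steps coincide, restrict them to the union [S] of the two
  images, where they form a critical pair, non-garbage because [S] is a subgraph
  of [G]. Then [G] is the gluing to [S] of the rest of [G] along the discrete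
  graph of persistent nodes: by the dangling condition an edge outside [S] can
  only be attached to [S] at persistent nodes. Strong joinability keeps these
  nodes alive up to [M], so the rest of [G] can be glued to every graph of both
  derivations, and the equality of tracks makes the two final gluings agree. *)

(** * Finite functions and the complement of a codomain *)

Lemma inj_surj_bij (A B : finType) (f : A -> B) :
  injective f -> (forall y, exists x, f x = y) -> bijective f.
Proof.
move=> fI fS; have fT y : y \in codom f by have [x <-] := fS y; apply: codom_f.
exists (fun y => iinv (fT y)) => [x|y]; last exact: f_iinv.
by apply: fI; rewrite f_iinv.
Qed.

Lemma notin_codom (A B : finType) (f : A -> B) y :
  (y \notin codom f) = (y \notin f @: setT).
Proof.
by congr (~~ _); apply/codomP/imsetP => [[x ->]|[x _ ->]]; exists x.
Qed.

(** Images under an injection commute with intersections; [i] will be the inclusion of a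
    subgraph. *)
Lemma imset_comp_interS (A1 A2 B1 B2 T U : finType) (i : T -> U)
    (a1 : A1 -> T) (a2 : A2 -> T) (b1 : B1 -> T) (b2 : B2 -> T) :
  injective i ->
  a1 @: setT :&: a2 @: setT \subset b1 @: setT :&: b2 @: setT ->
  (i \o a1) @: setT :&: (i \o a2) @: setT
    \subset (i \o b1) @: setT :&: (i \o b2) @: setT.
Proof.
move=> iI ab; rewrite (imset_comp i a1) (imset_comp i a2) (imset_comp i b1).
rewrite (imset_comp i b2) -!imsetI; first exact: imsetS.
all: by move=> x y _ _; apply: iI.
Qed.

Lemma codom_or_val (A B : finType) (f : A -> B) y :
  (exists x, y = f x) \/ (exists n : {y | y \notin codom f}, y = val n).
Proof.
have [/codomP|yNf] := boolP (y \in codom f); first by left.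
by right; exists (exist _ y yNf).
Qed.

Section SumSplit.
Variables (A B : finType) (f : A -> B).

Definition sum_elim (X Y Z : Type) (g : X -> Z) (h : Y -> Z)
  (s : X + Y) : Z := match s with inl x => g x | inr y => h y end.

(** Each branch consumes its membership proof, hence the match on [boolP]. For injective [f] this is
    the inverse of [sum_elim f val]. *)
Definition codom_split (y : B) : A + {y : B | y \notin codom f} :=
  match boolP (y \in codom f) with
  | AltTrue yf => inl (iinv yf)
  | AltFalse yNf => inr (exist _ y yNf)
  end.

Lemma codom_splitK : cancel codom_split (sum_elim f val).
Proof.
by move=> y; rewrite /codom_split; case: {-}_ / boolP => //= yf; rewrite f_iinv.
Qed.

Lemma codom_split_codom x : injective f -> codom_split (f x) = inl x.
Proof.
rewrite /codom_split => fI; case: {-}_ / boolP => [xf|/negP[]]; last exact: codom_f.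
by congr inl; apply: fI; rewrite f_iinv.
Qed.

Lemma codom_split_val (y : {y : B | y \notin codom f}) :
  codom_split (val y) = inr y.
Proof.
rewrite /codom_split; case: {-}_ / boolP => [yf|yNf].
  by case/negP: (valP y).
by congr inr; apply: val_inj.
Qed.

(** Two injections that jointly cover [P] and meet only within the image of [f] present [P] as the
    disjoint union of [C] and of the part of [B] outside that image. *)
Lemma glued_bij (C P : finType) (a : B -> P) (c : C -> P) :
  injective a -> injective c ->
  (forall x y, a x = c y -> x \in codom f) ->
  (forall z, (exists y, c y = z) \/ (exists x, a x = z)) ->
  (forall x, exists y, a (f x) = c y) ->
  bijective (sum_elim c (a \o val : {y : B | y \notin codom f} -> P)).
Proof.
move=> aI cI ac sur afc; apply: inj_surj_bij.
  move=> [y|n] [y'|n'] /= => [/cI-> //|/esym/ac nf|/ac nf|/aI/val_inj-> //].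
    by case/negP: (valP n').
  by case/negP: (valP n).
move=> z; have [[y yz]|[x xz]] := sur z; first by exists (inl y).
have [/codomP[x' xE]|xNf] := boolP (x \in codom f); last by exists (inr (exist _ x xNf)).
by have [y yE] := afc x'; exists (inl y); rewrite /= -yE -xE.
Qed.

End SumSplit.

(** * Equality, composition and isomorphism of graph morphisms *)

Local Notation "g \om f" := (morph_comp g f) (at level 50).

Section Graphs.
Variable L : alphabet.
Implicit Types G H A C K P X : graph L.

(** The law fields are equations in finite types, so their proofs are irrelevant and only the two
    maps count. Diagrams can then be chased by rewriting with Leibniz equalities. *)
Lemma morph_ext G H (f g : morph G H) : morph_eq f g -> f = g.
Proof.
case: f g => [fv fe s t v e] [gv ge s' t' v' e'] [/= fgv fge].
have ? : fv = gv by exact: functional_extensionality.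
have ? : fe = ge by exact: functional_extensionality.
subst gv ge; congr Morph; apply: functional_extensionality_dep => x;
  exact: eq_irrelevance.
Qed.

Lemma morph_comp_assoc G H A C (h : morph A C) (g : morph H A) (f : morph G H) :
  h \om (g \om f) = (h \om g) \om f.
Proof. exact: morph_ext. Qed.

Definition morph_id G : morph G G :=
  @Morph L G G id id (fun=> erefl) (fun=> erefl) (fun=> erefl) (fun=> erefl).

Lemma morph_comp1 G H (f : morph G H) : f \om morph_id G = f.
Proof. exact: morph_ext. Qed.

Lemma morph_1comp G H (f : morph G H) : morph_id H \om f = f.
Proof. exact: morph_ext. Qed.

Lemma morph_iso_inv G H (f : morph G H) : morph_iso f ->
  exists2 f' : morph H G, f' \om f = morph_id G & f \om f' = morph_id H.
Proof.
case=> [[v vK Kv] [e eK Ke]].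
have s x : src (e x) = v (src x) by rewrite -[x in RHS]Ke morph_src vK.
have t x : tgt (e x) = v (tgt x) by rewrite -[x in RHS]Ke morph_tgt vK.
have l x : vlab (v x) = vlab x by rewrite -[x in RHS]Kv morph_vlab.
have m x : elab (e x) = elab x by rewrite -[x in RHS]Ke morph_elab.
by exists (Morph s t l m); apply: morph_ext.
Qed.

Lemma inv_morph_iso G H (f : morph G H) (f' : morph H G) :
  f' \om f = morph_id G -> f \om f' = morph_id H -> morph_iso f.
Proof.
move=> fK Kf; split.
  exists (vmap f') => x; first exact: (congr1 (fun h => vmap h x) fK).
  exact: (congr1 (fun h => vmap h x) Kf).
exists (emap f') => x; first exact: (congr1 (fun h => emap h x) fK).
exact: (congr1 (fun h => emap h x) Kf).
Qed.

Lemma isomorphic_sym G H : isomorphic G H -> isomorphic H G.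
Proof.
by case=> f /morph_iso_inv[f' fK Kf]; exists f'; apply: inv_morph_iso fK.
Qed.

Lemma morph_iso_comp G H A (g : morph H A) (f : morph G H) :
  morph_iso f -> morph_iso g -> morph_iso (g \om f).
Proof. by move=> [fv fe] [gv ge]; split; apply: bij_comp. Qed.

(** * Subgraphs and corestriction of morphisms *)

Lemma sub_node G (S : subgraph G) x : x \in subV S ->
  exists y : V (graph_of_sub S), val y = x.
Proof. by move=> xS; exists (exist (fun z => z \in subV S) x xS). Qed.

Lemma sub_edge G (S : subgraph G) x : x \in subE S ->
  exists y : E (graph_of_sub S), val y = x.
Proof. by move=> xS; exists (exist (fun z => z \in subE S) x xS). Qed.

Lemma incl_mono G (S : subgraph G) H (f g : morph H (graph_of_sub S)) :
  incl S \om f = incl S \om g -> f = g.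
Proof.
move=> fg; apply: morph_ext; split => x; apply: val_inj.
  exact: (congr1 (fun h => vmap h x) fg).
exact: (congr1 (fun h => emap h x) fg).
Qed.

Lemma morph_corestr G (S : subgraph G) H (f : morph H G) :
  (forall x, vmap f x \in subV S) -> (forall e, emap f e \in subE S) ->
  exists f' : morph H (graph_of_sub S), incl S \om f' = f.
Proof.
move=> fV fE.
pose v x : V (graph_of_sub S) := exist (fun z => z \in subV S) _ (fV x).
pose e x : E (graph_of_sub S) := exist (fun z => z \in subE S) _ (fE x).
have s x : src (e x) = v (src x) by apply: val_inj; rewrite /= morph_src.
have t x : tgt (e x) = v (tgt x) by apply: val_inj; rewrite /= morph_tgt.
have l x : vlab (v x) = vlab x by rewrite /= morph_vlab.
have m x : elab (e x) = elab x by rewrite /= morph_elab.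
by exists (Morph s t l m); apply: morph_ext.
Qed.

(** * Pushouts of graphs *)

Lemma pushoutP A C K P (f : morph K A) (k : morph K C)
    (p : morph A P) (q : morph C P) :
  pushout f k p q <->
  p \om f = q \om k /\
  forall X (u : morph A X) (v : morph C X), u \om f = v \om k ->
    exists w : morph P X, [/\ w \om p = u, w \om q = v &
      forall w', w' \om p = u -> w' \om q = v -> w' = w].
Proof.
split=> [[/morph_ext pf univ]|[pf univ]]; split; rewrite ?pf // => X u v.
- move=> uv; have [|w [[/morph_ext wp /morph_ext wq] wU]] := univ X u v; first by rewrite uv.
  exists w; split=> // w' w'p w'q; apply: morph_ext; apply: wU.
  by rewrite w'p w'q.
- move=> /morph_ext uv; have [w [wp wq wU]] := univ X u v uv.
  exists w; split; first by rewrite wp wq.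
  by move=> w' [/morph_ext w'p /morph_ext w'q]; rewrite (wU w').
Qed.

Lemma pushout_unique A C K P P' (f : morph K A) (k : morph K C)
    (p : morph A P) (q : morph C P) (p' : morph A P') (q' : morph C P') :
  pushout f k p q -> pushout f k p' q' ->
  exists phi : morph P P', [/\ morph_iso phi, phi \om p = p' & phi \om q = q'].
Proof.
move=> /pushoutP[pf univ] /pushoutP[pf' univ'].
have [w [wp wq _]] := univ P' p' q' pf'.
have [w' [wp' wq' _]] := univ' P p q pf.
exists w; split=> //; apply: (@inv_morph_iso _ _ _ w').
  have [i [_ _ iU]] := univ P p q pf.
  rewrite [LHS]iU -?morph_comp_assoc ?wp ?wq // [RHS]iU ?morph_1comp //.
have [i [_ _ iU]] := univ' P' p' q' pf'.
by rewrite [LHS]iU -?morph_comp_assoc ?wp' ?wq' // [RHS]iU ?morph_1comp.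
Qed.

Lemma pushout_iso_leg A C C' K P (f : morph K A) (k : morph K C) (k' : morph K C')
    (p : morph A P) (q : morph C P) (phi : morph C' C) :
  morph_iso phi -> phi \om k' = k -> pushout f k p q ->
  pushout f k' p (q \om phi).
Proof.
move=> /morph_iso_inv[psi phiK Kphi] <- /pushoutP[pf univ]; apply/pushoutP.
split=> [|X u v uv]; first by rewrite -morph_comp_assoc.
have [|w [wp wq wU]] := univ X u (v \om psi).
  by rewrite -morph_comp_assoc [psi \om _]morph_comp_assoc phiK morph_1comp.
exists w; split=> // [|w' w'p w'q].
  by rewrite morph_comp_assoc wq -morph_comp_assoc phiK morph_comp1.
apply: wU => //.
by rewrite -w'q -!morph_comp_assoc Kphi morph_comp1.
Qed.

(** The bijections split [P] into a copy of [C] and the rest of [A], which forces the mediating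
    morphism: [v] on the first part, [u] on the second. *)
Lemma pushout_of_bij A C K P (f : morph K A) (k : morph K C)
    (p : morph A P) (q : morph C P) :
  p \om f = q \om k ->
  bijective (sum_elim (vmap q)
    (vmap p \o val : {x | x \notin codom (vmap f)} -> V P)) ->
  bijective (sum_elim (emap q)
    (emap p \o val : {x | x \notin codom (emap f)} -> E P)) ->
  pushout f k p q.
Proof.
move=> pf [iv ivK Kiv] [ie ieK Kie]; apply/pushoutP; split=> // X u v uv.
pose wv z := sum_elim (vmap v) (vmap u \o val) (iv z).
pose we z := sum_elim (emap v) (emap u \o val) (ie z).
have wvq y : wv (vmap q y) = vmap v y by rewrite /wv (ivK (inl y)).
have weq y : we (emap q y) = emap v y by rewrite /we (ieK (inl y)).
(* On the image of [f] the value of [u] is not taken by definition; it comes from [v] through the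
   two commuting squares. *)
have wvp x : wv (vmap p x) = vmap u x.
  have [/codomP[y ->]|xf] := boolP (x \in codom (vmap f)).
    transitivity (wv (vmap q (vmap k y))).
      by congr wv; apply: (congr1 (fun h => vmap h y) pf).
    by rewrite wvq; apply: esym; apply: (congr1 (fun h => vmap h y) uv).
  by rewrite /wv (ivK (inr (exist _ x xf))).
have wep x : we (emap p x) = emap u x.
  have [/codomP[y ->]|xf] := boolP (x \in codom (emap f)).
    transitivity (we (emap q (emap k y))).
      by congr we; apply: (congr1 (fun h => emap h y) pf).
    by rewrite weq; apply: esym; apply: (congr1 (fun h => emap h y) uv).
  by rewrite /we (ieK (inr (exist _ x xf))).
have casev z : (exists x, z = vmap p x) \/ (exists y, z = vmap q y).
  by rewrite -[z]Kiv; case: (iv z) => [y|[x xf]]; [right; exists y | left; exists x].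
have casee z : (exists x, z = emap p x) \/ (exists y, z = emap q y).
  by rewrite -[z]Kie; case: (ie z) => [y|[x xf]]; [right; exists y | left; exists x].
have s z : src (we z) = wv (src z).
  by case: (casee z) => -[x ->]; rewrite ?wep ?weq !morph_src ?wvp ?wvq.
have t z : tgt (we z) = wv (tgt z).
  by case: (casee z) => -[x ->]; rewrite ?wep ?weq !morph_tgt ?wvp ?wvq.
have l z : vlab (wv z) = vlab z.
  by case: (casev z) => -[x ->]; rewrite ?wvp ?wvq !morph_vlab.
have m z : elab (we z) = elab z.
  by case: (casee z) => -[x ->]; rewrite ?wep ?weq !morph_elab.
exists (Morph s t l m); split; [exact: morph_ext|exact: morph_ext|].
move=> w' w'p w'q; apply: morph_ext; split=> z /=.
  case: (casev z) => -[x ->]; rewrite ?wvp ?wvq.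
    exact: (congr1 (fun h => vmap h x) w'p).
  exact: (congr1 (fun h => vmap h x) w'q).
case: (casee z) => -[x ->]; rewrite ?wep ?weq.
  exact: (congr1 (fun h => emap h x) w'p).
exact: (congr1 (fun h => emap h x) w'q).
Qed.

(** * The explicit gluing of two graphs *)

Section Glue.
Variables (K A C : graph L) (f : morph K A) (k : morph K C).

(* Only meaningful for injective [f]: otherwise [codom_split] picks arbitrary
   preimages and the gluing below is not a pushout. *)
Definition glue_vmap x : V C + {x | x \notin codom (vmap f)} :=
  sum_elim (inl \o vmap k) inr (codom_split (vmap f) x).
Definition glue_emap x : E C + {x | x \notin codom (emap f)} :=
  sum_elim (inl \o emap k) inr (codom_split (emap f) x).

(** The carrier is [C] plus what [A] has outside the image of [f]. An edge of the second part may
    end in [C], so its endpoints pass through [glue_vmap]. *)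
Definition glue : graph L :=
  @Graph L (V C + {x | x \notin codom (vmap f)})%type
    (E C + {x | x \notin codom (emap f)})%type
    (sum_elim (inl \o @src L C) (glue_vmap \o @src L A \o val))
    (sum_elim (inl \o @tgt L C) (glue_vmap \o @tgt L A \o val))
    (sum_elim (@vlab L C) (@vlab L A \o val))
    (sum_elim (@elab L C) (@elab L A \o val)).

Definition glue_r : morph C glue :=
  @Morph L C glue inl inl (fun=> erefl) (fun=> erefl) (fun=> erefl) (fun=> erefl).

Hypothesis f_inj : morph_inj f.

Lemma glue_vmap_f x : glue_vmap (vmap f x) = inl (vmap k x).
Proof. by rewrite /glue_vmap codom_split_codom //; case: f_inj. Qed.

Lemma glue_emap_f x : glue_emap (emap f x) = inl (emap k x).
Proof. by rewrite /glue_emap codom_split_codom //; case: f_inj. Qed.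

Lemma glue_vmap_val n : glue_vmap (val n) = inr n.
Proof. by rewrite /glue_vmap codom_split_val. Qed.

Lemma glue_emap_val n : glue_emap (val n) = inr n.
Proof. by rewrite /glue_emap codom_split_val. Qed.

Definition glue_l : morph A glue.
Proof.
exists (glue_vmap : V A -> V glue) (glue_emap : E A -> E glue) => x.
- have [[y ->]|[n ->]] := codom_or_val (emap f) x; last by rewrite glue_emap_val.
  by rewrite glue_emap_f /= !morph_src glue_vmap_f.
- have [[y ->]|[n ->]] := codom_or_val (emap f) x; last by rewrite glue_emap_val.
  by rewrite glue_emap_f /= !morph_tgt glue_vmap_f.
- have [[y ->]|[n ->]] := codom_or_val (vmap f) x; last by rewrite glue_vmap_val.
  by rewrite glue_vmap_f /= !morph_vlab.
- have [[y ->]|[n ->]] := codom_or_val (emap f) x; last by rewrite glue_emap_val.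
  by rewrite glue_emap_f /= !morph_elab.
Defined.

Lemma glue_comm : glue_l \om f = glue_r \om k.
Proof.
by apply: morph_ext; split=> x /=; rewrite (glue_vmap_f, glue_emap_f).
Qed.

Lemma glue_pushout : pushout f k glue_l glue_r.
Proof.
apply: pushout_of_bij glue_comm _ _.
  by exists id => -[x|n] //=; rewrite glue_vmap_val.
by exists id => -[x|n] //=; rewrite glue_emap_val.
Qed.

Lemma glue_l_inj : morph_inj k -> morph_inj glue_l.
Proof.
move=> [kv ke]; split; apply: inj_comp (can_inj (codom_splitK _)).
  by move=> [x|n] [y|n'] //= [] => [/kv ->|->].
by move=> [x|n] [y|n'] //= [] => [/ke ->|->].
Qed.

End Glue.

Lemma glue_r_inj K A C (f : morph K A) (k : morph K C) : morph_inj (glue_r f k).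
Proof. by split=> x y []. Qed.

(** Internal criterion, used to recognise a given graph as the gluing of two of its subgraphs. *)
Lemma pushout_of_inter A C K P (f : morph K A) (k : morph K C)
    (p : morph A P) (q : morph C P) :
  morph_inj p -> morph_inj q -> p \om f = q \om k ->
  (forall x y, vmap p x = vmap q y -> x \in codom (vmap f)) ->
  (forall x y, emap p x = emap q y -> x \in codom (emap f)) ->
  (forall z, (exists y, vmap q y = z) \/ (exists x, vmap p x = z)) ->
  (forall z, (exists y, emap q y = z) \/ (exists x, emap p x = z)) ->
  pushout f k p q.
Proof.
move=> [pv pe] [qv qe] pf iv ie sv se; apply: pushout_of_bij => //.
  apply: glued_bij => // x; exists (vmap k x).
  exact: (congr1 (fun h => vmap h x) pf).
apply: glued_bij => // x; exists (emap k x).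
exact: (congr1 (fun h => emap h x) pf).
Qed.

Lemma glue_iso K A C C' (f : morph K A) (k : morph K C) (k' : morph K C')
    (phi : morph C C') :
  morph_inj f -> morph_iso phi -> phi \om k = k' ->
  isomorphic (glue f k) (glue f k').
Proof.
move=> fI phiI phik.
have po := pushout_iso_leg phiI phik (glue_pushout k' fI).
by have [psi [psiI _ _]] := pushout_unique (glue_pushout k fI) po; exists psi.
Qed.

(** * Direct derivations up to isomorphism *)

Lemma deletedV_comp r G H (h : morph G H) (g : morph (lhs r) G) :
  deletedV (h \om g) = vmap h @: deletedV g.
Proof. by rewrite /deletedV imset_comp. Qed.

Lemma deletedE_comp r G H (h : morph G H) (g : morph (lhs r) G) :
  deletedE (h \om g) = emap h @: deletedE g.
Proof. by rewrite /deletedE imset_comp. Qed.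

Lemma morph_iso_inj G H (f : morph G H) : morph_iso f -> morph_inj f.
Proof. by case=> /bij_inj ? /bij_inj. Qed.

Lemma morph_inj_comp G H A (g : morph H A) (f : morph G H) :
  morph_inj f -> morph_inj g -> morph_inj (g \om f).
Proof. by move=> [fv fe] [gv ge]; split; apply: inj_comp. Qed.

Lemma incl_inj G (S : subgraph G) : morph_inj (incl S).
Proof. by split; apply: val_inj. Qed.

Lemma morph_inj_cancel G H A (g : morph H A) (f : morph G H) :
  morph_inj (g \om f) -> morph_inj f.
Proof.
move=> [fv fe]; split=> x y xy; [apply: fv|apply: fe]; by rewrite /= xy.
Qed.

Lemma morph_iso_bij G H (f : morph G H) : morph_inj f ->
  (forall y, exists x, vmap f x = y) -> (forall y, exists x, emap f x = y) ->
  morph_iso f.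
Proof. by move=> [fv fe] sv se; split; apply: inj_surj_bij. Qed.

(** An isomorphism that carries one match to the other carries deleted items to deleted items, hence
    restricts to the contexts. *)
Lemma context_iso r G G' (g : rule_match r G) (g' : rule_match r G')
    (f : morph G G') :
  morph_iso f -> f \om g = g' ->
  exists phi : morph (graph_of_sub (context g)) (graph_of_sub (context g')),
    morph_iso phi /\ incl (context g') \om phi = f \om incl (context g).
Proof.
move=> fI fg; have [fvI feI] := morph_iso_inj fI.
have [[fv' _ fvK] [fe' _ feK]] := fI.
have dV x : (vmap f x \in deletedV g') = (x \in deletedV g).
  by rewrite -fg deletedV_comp mem_imset.
have dE x : (emap f x \in deletedE g') = (x \in deletedE g).
  by rewrite -fg deletedE_comp mem_imset.
have [x|x|phi phiE] := @morph_corestr G' (context g') _ (f \om incl (context g)).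
- by rewrite inE /= dV -in_setC (valP x).
- by rewrite inE /= dE -in_setC (valP x).
exists phi; split=> //; apply: morph_iso_bij.
- apply: (@morph_inj_cancel _ _ _ (incl (context g'))); rewrite phiE.
  by apply: morph_inj_comp (@incl_inj _ _) _.
- move=> y; have yD : fv' (val y) \in ~: deletedV g.
    by rewrite inE -dV fvK -in_setC (valP y).
  have [x xE] := @sub_node _ (context g) _ yD; exists x; apply: val_inj.
  by rewrite [LHS](congr1 (fun h => vmap h x) phiE) /= xE fvK.
- move=> y; have yD : fe' (val y) \in ~: deletedE g.
    by rewrite inE -dE feK -in_setC (valP y).
  have [x xE] := @sub_edge _ (context g) _ yD; exists x; apply: val_inj.
  by rewrite [LHS](congr1 (fun h => emap h x) phiE) /= xE feK.
Qed.

Lemma dd_restrE r G H (d : direct_derivation r G H) :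
  incl (context (dd_match d)) \om dd_interface d = dd_match d \om to_lhs r.
Proof. exact/morph_ext/dd_restr. Qed.

(** Both results are pushouts of the same span once the contexts are identified. *)
Lemma dd_unique r G G' H H' (d : direct_derivation r G H)
    (d' : direct_derivation r G' H') (f : morph G G') :
  morph_iso f -> f \om dd_match d = dd_match d' -> isomorphic H H'.
Proof.
move=> fI fg; have [phi [phiI phiE]] := context_iso fI fg.
have phik : phi \om dd_interface d = dd_interface d'.
  apply: incl_mono; rewrite morph_comp_assoc phiE -morph_comp_assoc !dd_restrE.
  by rewrite -fg morph_comp_assoc.
have po := pushout_iso_leg phiI phik (dd_gluing d').
by have [psi [psiI _ _]] := pushout_unique (dd_gluing d) po; exists psi.
Qed.

(** The match is pulled back along [f]. Only the context changes, and by an isomorphism, so the same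
    [Z] remains a pushout. *)
Lemma dd_transport r G X Z (f : morph G X) :
  morph_iso f -> direct_derivation r X Z -> inhabited (direct_derivation r G Z).
Proof.
move=> fI d; have [f' fK Kf] := morph_iso_inv fI.
have f'I : morph_inj f' by apply: morph_iso_inj; apply: inv_morph_iso fK.
have gI : morph_inj (f' \om dd_match d).
  exact: morph_inj_comp (match_inj _) f'I.
have gD : dangling_condition (f' \om dd_match d).
  move=> e eN; rewrite deletedV_comp.
  have fe x : emap f' (emap f x) = x := congr1 (fun h => emap h x) fK.
  have [|sD tD] := @match_dangling _ _ _ (dd_match d) (emap f e).
    apply: contra eN => /imsetP[x _ xe]; apply/imsetP; exists x => //=.
    by rewrite -xe fe.
  rewrite -(fe e) morph_src morph_tgt !mem_imset //; exact: f'I.1.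
pose g := RuleMatch gI gD.
have fg : f \om g = dd_match d.
  by rewrite /= morph_comp_assoc Kf morph_1comp.
clearbody g; have [phi [phiI phiE]] := context_iso fI fg.
have [psi phiK Kphi] := morph_iso_inv phiI.
have fmono : forall (h h' : morph (interface r) G), f \om h = f \om h' -> h = h'.
  by move=> h h' hh'; rewrite -[h]morph_1comp -fK -morph_comp_assoc hh'
    morph_comp_assoc fK morph_1comp.
have res : incl (context g) \om (psi \om dd_interface d) = g \om to_lhs r.
  apply: fmono; rewrite !morph_comp_assoc -phiE fg -[(_ \om phi) \om psi]morph_comp_assoc.
  by rewrite Kphi morph_comp1 dd_restrE.
have po := @pushout_iso_leg _ _ _ _ _ _ _ (psi \om dd_interface d) _ _ phi phiI _ (dd_gluing d).
split; apply: (@DirectDerivation _ _ _ _ g (psi \om dd_interface d)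
  (dd_in' d \om phi) (dd_comatch d)); first by rewrite res.
by apply: po; rewrite morph_comp_assoc Kphi morph_1comp.
Qed.

(** Only the head changes: the final isomorphism of an empty derivation, or else its first step. *)
Lemma derivation_transport rules G X M :
  isomorphic G X -> derivation rules X M -> inhabited (derivation rules G M).
Proof.
move=> [f fI] ds; case: {X M} ds f fI => [X M h hI|X Z M r rR d ds] f fI.
  by split; apply: DerivIso (morph_iso_comp fI hI).
by have [d'] := dd_transport fI d; split; apply: DerivStep rR d' ds.
Qed.

(** An edge of [S] outside the restricted image is also outside the image in [G], and deleted nodes
    correspond under the inclusion, so the dangling condition is inherited. *)
Lemma match_restrict r G (g : rule_match r G) (S : subgraph G) :
  (forall x, vmap g x \in subV S) -> (forall e, emap g e \in subE S) ->
  exists g' : rule_match r (graph_of_sub S), incl S \om g' = g.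
Proof.
move=> gV gE; have [g' g'E] := morph_corestr gV gE.
have gI : morph_inj g'.
  by apply: (@morph_inj_cancel _ _ _ (incl S)); rewrite g'E; apply: match_inj.
have gD : dangling_condition g'.
  move=> e eN; have [|sD tD] := @match_dangling _ _ _ g (val e).
    apply: contra eN => /imsetP[x _ xe]; apply/imsetP; exists x => //.
    by apply: val_inj; rewrite xe -g'E.
  move: sD tD; rewrite -g'E deletedV_comp => sD tD.
  by split; [apply: contra sD|apply: contra tD]; apply: imset_f.
by exists (RuleMatch gI gD).
Qed.

(** * Steps at a given match and their extension by gluing *)

Lemma deletedVP r G (g : rule_match r G) x :
  vmap g x \in deletedV g -> x \notin codom (vmap (to_lhs r)).
Proof.
rewrite notin_codom mem_imset ?inE //; exact: (match_inj g).1.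
Qed.

Lemma match_interface_kept r G (g : rule_match r G) x :
  vmap g (vmap (to_lhs r) x) \notin deletedV g.
Proof. by apply/negP => /deletedVP; rewrite codom_f. Qed.

Lemma deletedEP r G (g : rule_match r G) x :
  emap g x \in deletedE g -> x \notin codom (emap (to_lhs r)).
Proof.
rewrite notin_codom mem_imset ?inE //; exact: (match_inj g).2.
Qed.

Lemma match_interface_keptE r G (g : rule_match r G) x :
  emap g (emap (to_lhs r) x) \notin deletedE g.
Proof. by apply/negP => /deletedEP; rewrite codom_f. Qed.

(** Taking the explicit gluing as the result makes [dd_in'] injective, as the closing step of the
    independent case requires. *)
Lemma match_rewrite r G (g : rule_match r G) :
  exists H (d : direct_derivation r G H), dd_match d = g /\ morph_inj (dd_in' d).
Proof.
have [x|x|k kE] := @morph_corestr G (context g) _ (g \om to_lhs r).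
- by rewrite inE match_interface_kept.
- by rewrite inE match_interface_keptE.
have kR : morph_eq (incl (context g) \om k) (g \om to_lhs r) by rewrite kE.
exists (glue (to_rhs r) k).
exists (DirectDerivation kR (glue_pushout k (@to_rhs_inj _ r))).
by split=> //; apply: glue_r_inj.
Qed.

(** A step that keeps all attachment points, as [kc] witnesses, can be performed with [A] attached.
    Its context is [A] glued to the old context, and gluing the right-hand side and gluing [A] can
    be done in either order. *)
Lemma glue_step r H H' K A (d : direct_derivation r H H') (f : morph K A)
    (k : morph K H) (kc : morph K (graph_of_sub (context (dd_match d)))) :
  morph_inj f -> incl (context (dd_match d)) \om kc = k ->
  exists d' : direct_derivation r (glue f k) (glue f (dd_in' d \om kc)),
    match_morph (dd_match d') = glue_r f k \om dd_match d.
Proof.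
move=> fI kE; set D := context (dd_match d) in kc kE *.
set k' := dd_in' d \om kc; set g := dd_match d in D kc kE k' *.
have kD x : vmap k x \notin deletedV g.
  by have := valP (vmap kc x); rewrite inE -kE.
have kDe x : emap k x \notin deletedE g.
  by have := valP (emap kc x); rewrite inE -kE.
have delV : deletedV (glue_r f k \om g) = vmap (glue_r f k) @: deletedV g.
  exact: deletedV_comp.
have delE : deletedE (glue_r f k \om g) = emap (glue_r f k) @: deletedE g.
  exact: deletedE_comp.
have rV (x : V H) (S : {set V H}) : (inl x \in vmap (glue_r f k) @: S) = (x \in S).
  by rewrite -[inl x]/(vmap (glue_r f k) x) mem_imset //; apply: (@glue_r_inj _ _ _ f k).1.
have rE (x : E H) (S : {set E H}) : (inl x \in emap (glue_r f k) @: S) = (x \in S).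
  by rewrite -[inl x]/(emap (glue_r f k) x) mem_imset //; apply: (@glue_r_inj _ _ _ f k).2.
(* Nothing coming from [A] is deleted: the part shared with [H] lies in the context, and the rest is
   outside the match. *)
have lV x : glue_vmap f k x \notin deletedV (glue_r f k \om g).
  rewrite delV; have [[y ->]|[n ->]] := codom_or_val (vmap f) x.
    by rewrite glue_vmap_f // rV.
  by rewrite glue_vmap_val; apply/imsetP => -[].
have lE x : glue_emap f k x \notin deletedE (glue_r f k \om g).
  rewrite delE; have [[y ->]|[n ->]] := codom_or_val (emap f) x.
    by rewrite glue_emap_f // rE.
  by rewrite glue_emap_val; apply/imsetP => -[].
have gI : morph_inj (glue_r f k \om g).
  exact: morph_inj_comp (match_inj g) (@glue_r_inj _ _ _ f k).
have gD : dangling_condition (glue_r f k \om g).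
  (* An edge [inr n] comes from [A], so its endpoints are kept by [lV]; an edge of [H] inherits the
     condition from the old match. *)
  case=> [e|n] eN; last by split; apply: lV.
  have [|sD tD] := @match_dangling _ _ _ g e.
    apply: contra eN => /imsetP[x _ ->]; exact: (imset_f (emap (glue_r f k \om g))).
  by rewrite delV !rV.
pose g' := RuleMatch gI gD; pose D' := context g'.
have [x|x|j jE] := @morph_corestr _ D' _ (glue_r f k \om incl D).
- by rewrite inE delV rV; have := valP x; rewrite inE.
- by rewrite inE delE rE; have := valP x; rewrite inE.
have [x|x|l lE'] := @morph_corestr _ D' _ (glue_l k fI).
- by rewrite inE; apply: lV.
- by rewrite inE; apply: lE.
have jv x : val (vmap j x) = inl (val x) := congr1 (fun h => vmap h x) jE.
have je x : val (emap j x) = inl (val x) := congr1 (fun h => emap h x) jE.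
have lv x : val (vmap l (val x)) = inr x.
  by rewrite [LHS](congr1 (fun h => vmap h _) lE') /= glue_vmap_val.
have le x : val (emap l (val x)) = inr x.
  by rewrite [LHS](congr1 (fun h => emap h _) lE') /= glue_emap_val.
have ljk : l \om f = j \om kc.
  by apply: incl_mono; rewrite !morph_comp_assoc lE' jE -morph_comp_assoc kE glue_comm.
(* The new context is the gluing of [A] to the old one. *)
have po : pushout f kc l j.
  apply: pushout_of_bij ljk _ _; apply: inj_surj_bij.
  - move=> [x|x] [y|y] /= /(congr1 val); rewrite ?jv ?lv => // -[].
      by move=> /val_inj->.
    by move=> ->.
  - move=> z; case zE: (val z) => [x|n]; last first.
      by exists (inr n); apply: val_inj; rewrite [LHS]lv.
    have xD : x \in ~: deletedV g.
      have := valP z; rewrite zE !inE; apply: contra => xD.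
      by rewrite delV; apply: (imset_f (vmap (glue_r f k))).
    have [y yE] := @sub_node _ D _ xD.
    by exists (inl y); apply: val_inj; rewrite [LHS]jv yE zE.
  - move=> [x|x] [y|y] /= /(congr1 val); rewrite ?je ?le => // -[].
      by move=> /val_inj->.
    by move=> ->.
  - move=> z; case zE: (val z) => [x|n]; last first.
      by exists (inr n); apply: val_inj; rewrite [LHS]le.
    have xD : x \in ~: deletedE g.
      have := valP z; rewrite zE !inE; apply: contra => xD.
      by rewrite delE; apply: (imset_f (emap (glue_r f k))).
    have [y yE] := @sub_edge _ D _ xD.
    by exists (inl y); apply: val_inj; rewrite [LHS]je yE zE.
have [_ univ] := (pushoutP _ _ _ _).1 po.
have [_ univ'] := (pushoutP _ _ _ _).1 (glue_pushout k' fI).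
have [pd univd] := (pushoutP _ _ _ _).1 (dd_gluing d).
(* This [i] will be the morphism from the new context to the new result. *)
have [|i [il ij _]] := univ _ (glue_l k' fI) (glue_r f k' \om dd_in' d).
  by rewrite glue_comm -morph_comp_assoc.
have res : morph_eq (incl D' \om (j \om dd_interface d)) (g' \om to_lhs r).
  by rewrite morph_comp_assoc jE -morph_comp_assoc dd_restrE morph_comp_assoc.
suff dgl : pushout (to_rhs r) (j \om dd_interface d)
    (glue_r f k' \om dd_comatch d) i by exists (DirectDerivation res dgl).
apply/pushoutP; split=> [|X u v uv].
  by rewrite morph_comp_assoc ij -!morph_comp_assoc pd.
(* The mediating morphism is built in two stages: [w] on [H'], then [w2] on [H'] with [A] attached.
   Uniqueness for [po] then gives that [w2] after [i] is [v]. *)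
have [|w [wu wv wU]] := univd X u (v \om j); first by rewrite uv morph_comp_assoc.
have [|w2 [w2l w2r w2U]] := univ' X (v \om l) w.
  by rewrite -morph_comp_assoc ljk /k' !morph_comp_assoc wv.
exists w2; split.
- by rewrite morph_comp_assoc w2r.
- have [|w3 [_ _ w3U]] := univ X (v \om l) (v \om j).
    by rewrite -!morph_comp_assoc ljk.
  rewrite (w3U v) // (w3U (w2 \om i)) // -morph_comp_assoc.
    by rewrite il.
  by rewrite ij morph_comp_assoc w2r wv.
- move=> w' w'u w'v; apply: w2U; first by rewrite -il morph_comp_assoc w'v.
  apply: wU; first by rewrite -morph_comp_assoc.
  by rewrite -w'v -!morph_comp_assoc ij.
Qed.

(** * Tracks of nodes and extension of whole derivations *)

Lemma track1 r G H (d : direct_derivation r G H)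
    (x : V (graph_of_sub (context (dd_match d)))) :
  track d [set val x] = [set vmap (dd_in' d) x].
Proof.
apply/setP => z; apply/imsetP/set1P => [[y]|->].
  by rewrite inE => /set1P/val_inj -> ->.
by exists x; rewrite // !inE.
Qed.

Lemma track_neq0 r G H (d : direct_derivation r G H) v :
  track d [set v] != set0 -> v \in subV (context (dd_match d)).
Proof. by case/set0Pn=> z /imsetP[y]; rewrite inE => /set1P <- _; apply: valP. Qed.

(** A node once lost stays lost, so a nonempty final track shows that the node survived the first
    step. *)
Lemma derivation_track0 rules G H (d : derivation rules G H) :
  derivation_track d set0 = set0.
Proof.
elim: d => [{}G {}H f fI|{}G {}H M r rR d ds IH] /=; first by rewrite imset0.
by rewrite /track preimset0 imset0.
Qed.

Lemma track_neq0E r G H (d : direct_derivation r G H) v :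
  track d [set v] != set0 -> exists2 x, val x = v & track d [set v] = [set vmap (dd_in' d) x].
Proof.
by move=> /track_neq0/sub_node[x xv]; exists x; rewrite // -xv track1.
Qed.

(** Each step tracks a surviving node by a label-preserving function. The label clause later makes
    the choice of tracked nodes a graph morphism. *)
Lemma derivation_track_point rules G H (d : derivation rules G H) v :
  derivation_track d [set v] != set0 ->
  exists w, derivation_track d [set v] = [set w] /\ vlab w = vlab v.
Proof.
elim: d v => [{}G {}H f fI|{}G {}H M r rR d ds IH] v /=.
  by move=> _; exists (vmap f v); rewrite imset_set1 morph_vlab.
move=> ne0; have [tr0|/track_neq0E[x xv trE]] := eqVneq (track d [set v]) set0.
  by rewrite tr0 derivation_track0 eqxx in ne0.
move: ne0; rewrite trE => /IH[w [-> wl]]; exists w; split=> //.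
by rewrite wl morph_vlab -xv.
Qed.

Lemma edgeless_morph K G (v : V K -> V G) : (E K -> False) ->
  (forall x, vlab (v x) = vlab x) -> exists k : morph K G, vmap k = v.
Proof.
move=> K0 vl; pose e x : E G := False_rect _ (K0 x).
by exists (@Morph L K G v e (fun x => False_ind _ (K0 x))
  (fun x => False_ind _ (K0 x)) vl (fun x => False_ind _ (K0 x))).
Qed.

(** Induction on the derivation: the nodes of the discrete [K] have nonempty tracks to the end, so
    they lie in every context and [glue_step] applies each time. *)
Lemma glue_derivation rules G M K A (ds : derivation rules G M) (f : morph K A)
    (k : morph K G) (k' : morph K M) :
  morph_inj f -> (E K -> False) ->
  (forall x, derivation_track ds [set vmap k x] = [set vmap k' x]) ->
  inhabited (derivation rules (glue f k) (glue f k')).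
Proof.
move=> fI K0; elim: ds k k' => [{}G {}M h hI|{}G H {}M r rR d ds IH] k k' /= kk'.
  have [|psi psiI] := @glue_iso _ _ _ _ f k k' h fI hI.
    apply: morph_ext; split=> x; last by case: (K0 x).
    by apply: set1_inj; rewrite -kk' imset_set1.
  by split; apply: DerivIso psiI.
have kD x : vmap k x \in subV (context (dd_match d)).
  apply: track_neq0; apply/negP => /eqP tr0.
  have /setP/(_ (vmap k' x)) := kk' x.
  by rewrite tr0 derivation_track0 !inE eqxx.
have [x|kc kcE] := morph_corestr kD; first by case: (K0 x).
have [d' _] := glue_step fI kcE.
have [|ds'] := IH (dd_in' d \om kc) k'.
  by move=> x; rewrite -kk' -kcE /= track1.
by split; apply: DerivStep rR d' ds'.
Qed.

(** * Parallelly independent steps *)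

Lemma rule_glue_step r C (k : morph (interface r) C) : morph_inj k ->
  inhabited (direct_derivation r (glue (to_lhs r) k) (glue (to_rhs r) k)).
Proof.
move=> kI; set f := to_lhs r; have fI : morph_inj f := @to_lhs_inj _ r.
pose G := glue f k; pose gl : morph (lhs r) G := glue_l k fI.
have glI : morph_inj gl by apply: glue_l_inj.
(* The deleted items are exactly those of the form [inr n], so the context is a copy of [C]. *)
have delV z : z \in deletedV gl -> exists n, z = inr n.
  case/imsetP=> x; rewrite inE -notin_codom => xN ->.
  by exists (exist _ x xN); apply: (@glue_vmap_val _ _ _ f k (exist _ x xN)).
have delE z : z \in deletedE gl -> exists n, z = inr n.
  case/imsetP=> x; rewrite inE -notin_codom => xN ->.
  by exists (exist _ x xN); apply: (@glue_emap_val _ _ _ f k (exist _ x xN)).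
have Vdel n : inr n \in deletedV gl.
  apply/imsetP; exists (val n); last by rewrite /= glue_vmap_val.
  by rewrite inE -notin_codom (valP n).
have Edel n : inr n \in deletedE gl.
  apply/imsetP; exists (val n); last by rewrite /= glue_emap_val.
  by rewrite inE -notin_codom (valP n).
have gD : dangling_condition gl.
  (* An edge of [C] has both endpoints in [C], where nothing is deleted; every other edge is in the
     image of the match. *)
  case=> [e|n] eN; first by split; apply/negP => /delV[].
  by case/imsetP: eN; exists (val n); rewrite //= glue_emap_val.
pose g := RuleMatch glI gD.
have [x|x|phi phiE] := @morph_corestr _ (context g) _ (glue_r f k).
- by rewrite inE; apply/negP => /delV[].
- by rewrite inE; apply/negP => /delE[].
have phiI : morph_iso phi.
  apply: morph_iso_bij.
  - by apply: (@morph_inj_cancel _ _ _ (incl (context g))); rewrite phiE; apply: glue_r_inj.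
  - move=> y; case yE: (val y) => [x|n]; last first.
      by have := valP y; rewrite yE !inE Vdel.
    by exists x; apply: val_inj; rewrite [LHS](congr1 (fun h => vmap h x) phiE) yE.
  - move=> y; case yE: (val y) => [x|n]; last first.
      by have := valP y; rewrite yE !inE Edel.
    by exists x; apply: val_inj; rewrite [LHS](congr1 (fun h => emap h x) phiE) yE.
have [psi phiK Kphi] := morph_iso_inv phiI.
have psik : psi \om (phi \om k) = k by rewrite morph_comp_assoc phiK morph_1comp.
have res : morph_eq (incl (context g) \om (phi \om k)) (g \om to_lhs r).
  by rewrite morph_comp_assoc phiE -(glue_comm k fI).
split; apply: (DirectDerivation res).
by apply: pushout_iso_leg psik (glue_pushout k (@to_rhs_inj _ r)); apply: inv_morph_iso Kphi _.
Qed.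

Lemma parallelly_independent_joinable rules r1 r2 G H1 H2
    (d1 : direct_derivation r1 G H1) (d2 : direct_derivation r2 G H2) :
  List.In r1 rules -> List.In r2 rules ->
  parallelly_independent d1 d2 -> joinable rules H1 H2.
Proof.
move=> r1R r2R [/subsetP pV /subsetP pE].
set g1 := dd_match d1 in pV pE *; set g2 := dd_match d2 in pV pE *.
pose k := dd_interface d1; have kE : incl (context g1) \om k = g1 \om to_lhs r1.
  exact: dd_restrE.
have interV x y : vmap g1 x = vmap g2 y ->
    x \in codom (vmap (to_lhs r1)) /\ y \in codom (vmap (to_lhs r2)).
  move=> xy; have := pV (vmap g1 x); rewrite !inE {2}xy !imset_f //.
  case/(_ isT)/andP => /imsetP[x' _ /(match_inj g1).1 xE] /imsetP[y' _].
  by rewrite xy => /(match_inj g2).1 ->; rewrite xE !codom_f.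
have interE x y : emap g1 x = emap g2 y ->
    x \in codom (emap (to_lhs r1)) /\ y \in codom (emap (to_lhs r2)).
  move=> xy; have := pE (emap g1 x); rewrite !inE {2}xy !imset_f //.
  case/(_ isT)/andP => /imsetP[x' _ /(match_inj g1).2 xE] /imsetP[y' _].
  by rewrite xy => /(match_inj g2).2 ->; rewrite xE !codom_f.
(* By independence the second match avoids everything the first step deletes, so it restricts to the
   first context. *)
have [x|x|g2' g2E] := @match_restrict _ _ g2 (context g1).
- rewrite inE; apply/imsetP => -[y]; rewrite inE -notin_codom => yN /esym xy.
  by have [yf _] := interV _ _ xy; rewrite yf in yN.
- rewrite inE; apply/imsetP => -[y]; rewrite inE -notin_codom => yN /esym xy.
  by have [yf _] := interE _ _ xy; rewrite yf in yN.
have kv x : val (vmap k x) = vmap g1 (vmap (to_lhs r1) x).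
  exact: (congr1 (fun h => vmap h x) kE).
have ke x : val (emap k x) = emap g1 (emap (to_lhs r1) x).
  exact: (congr1 (fun h => emap h x) kE).
have gv x : val (vmap g2' x) = vmap g2 x := congr1 (fun h => vmap h x) g2E.
have ge x : val (emap g2' x) = emap g2 x := congr1 (fun h => emap h x) g2E.
have [D' [d' [d'g inI]]] := match_rewrite g2'.
(* Symmetrically, the interface of the first rule avoids what the second step deletes. *)
have [x|x|kc kcE] := @morph_corestr _ (context (dd_match d')) _ k.
- rewrite inE d'g; apply/imsetP => -[y]; rewrite inE -notin_codom => yN xy.
  have [|_ yf] := interV (vmap (to_lhs r1) x) y; first by rewrite -kv xy gv.
  by rewrite yf in yN.
- rewrite inE d'g; apply/imsetP => -[y]; rewrite inE -notin_codom => yN xy.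
  have [|_ yf] := interE (emap (to_lhs r1) x) y; first by rewrite -ke xy ge.
  by rewrite yf in yN.
have kI : morph_inj k.
  apply: (@morph_inj_cancel _ _ _ (incl (context g1))); rewrite kE.
  by apply: morph_inj_comp (match_inj g1); apply: to_lhs_inj.
have kcI : morph_inj kc.
  by apply: (@morph_inj_cancel _ _ _ (incl (context (dd_match d')))); rewrite kcE.
(* The second step inside the context is extended by the left-hand side, a step from a copy of [G],
   and by the right-hand side, a step from a copy of [H1]. *)
have [dL dLg] := glue_step (@to_lhs_inj _ r1) kcE.
have [dR _] := glue_step (@to_rhs_inj _ r1) kcE.
have poL : pushout (to_lhs r1) k g1 (incl (context g1)).
  apply: pushout_of_inter; [exact: match_inj|exact: incl_inj|by []|..].
  - move=> x y xy; have := valP y; rewrite inE /= -[val y]xy.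
    by apply: contraR => xN; apply: imset_f; rewrite inE -notin_codom.
  - move=> x y xy; have := valP y; rewrite inE /= -[val y]xy.
    by apply: contraR => xN; apply: imset_f; rewrite inE -notin_codom.
  - move=> z; have [zD|] := boolP (z \in ~: deletedV g1).
      by left; apply: (@sub_node _ (context g1)).
    by rewrite inE negbK => /imsetP[x _ ->]; right; exists x.
  - move=> z; have [zD|] := boolP (z \in ~: deletedE g1).
      by left; apply: (@sub_edge _ (context g1)).
    by rewrite inE negbK => /imsetP[x _ ->]; right; exists x.
have [phi [phiI _ phir]] := pushout_unique (glue_pushout k (@to_lhs_inj _ r1)) poL.
have H2E : isomorphic (glue (to_lhs r1) (dd_in' d' \om kc)) H2.
  by apply: (dd_unique (d := dL) (d' := d2) phiI); rewrite dLg morph_comp_assoc phir d'g.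
have [psi [psiI _ _]] := pushout_unique (dd_gluing d1) (glue_pushout k (@to_rhs_inj _ r1)).
(* The first rule leads from the result of [dL], a copy of [H2], to the result of [dR]. *)
have [dM] := rule_glue_step (morph_inj_comp kcI inI).
pose M := glue (to_rhs r1) (dd_in' d' \om kc).
have idI : morph_iso (morph_id M) by split; exists id.
exists M; split.
  have [d] := dd_transport psiI dR.
  by split; apply: DerivStep r2R d (DerivIso _ idI).
have [f fI] := isomorphic_sym H2E; have [d] := dd_transport fI dM.
by split; apply: DerivStep r1R d (DerivIso _ idI).
Qed.

(** * Lifting strong joinability from a subgraph to the whole graph *)

Lemma strongly_joinable_lift rules r1 r2 G H1 H2 H1' H2' (S : subgraph G)
    (d1 : direct_derivation r1 G H1) (d2 : direct_derivation r2 G H2)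
    (d1' : direct_derivation r1 (graph_of_sub S) H1')
    (d2' : direct_derivation r2 (graph_of_sub S) H2') :
  incl S \om dd_match d1' = dd_match d1 -> incl S \om dd_match d2' = dd_match d2 ->
  strongly_joinable d1' d2' rules -> joinable rules H1 H2.
Proof.
move=> g1E g2E [M [ds1 [ds2 joinP]]].
pose P : {set V (graph_of_sub S)} := persistent d1' d2'.
(* An edge outside [S] is outside the match, so by the dangling condition in [G] its endpoints lying
   in [S] are not deleted. Applied to both steps, this makes them persistent. *)
have keep r H H' (d : direct_derivation r G H) (d' : direct_derivation r (graph_of_sub S) H') :
    incl S \om dd_match d' = dd_match d -> forall e, e \notin subE S ->
    forall v : V (graph_of_sub S), val v = src e \/ val v = tgt e ->
    track d' [set v] != set0.
  move=> gE e eS v ve.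
  have [|sD tD] := @match_dangling _ _ _ (dd_match d) e.
    apply: contra eS => /imsetP[x _ ->]; rewrite -gE /=; exact: valP.
  have vD : v \in subV (context (dd_match d')).
    rewrite inE; apply/negP => vD.
    have : val v \in deletedV (dd_match d).
      by rewrite -gE deletedV_comp; apply: (imset_f (vmap (incl S))).
    by case: ve => ->; apply/negP.
  have [x <-] := sub_node vD; rewrite track1; apply/set0Pn.
  by exists (vmap (dd_in' d') x); rewrite set11.
(* The discrete graph of persistent nodes; the two closure proofs refute membership in [set0]. *)
pose K := @Subgraph _ (graph_of_sub S) P set0
  (fun e eK => False_ind _ (Bool.diff_false_true (etrans (esym (in_set0 e)) eK)))
  (fun e eK => False_ind _ (Bool.diff_false_true (etrans (esym (in_set0 e)) eK))).
have K0 : E (graph_of_sub K) -> False by case=> e; rewrite inE.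
pose Av : {set V G} := ~: subV S :|: val @: P.
have Aend e x : e \in ~: subE S -> x = src e \/ x = tgt e -> x \in Av.
  rewrite !inE => eS xe; case: (boolP (x \in subV S)) => //= /sub_node[v vx].
  rewrite -vx; apply: imset_f; rewrite inE.
  by rewrite -vx in xe; rewrite (keep _ _ _ d1 _ g1E e) ?(keep _ _ _ d2 _ g2E e).
(* The rest of [G]: all edges outside [S], with the nodes outside [S] and the persistent ones as
   attachment points. *)
pose A := @Subgraph _ G Av (~: subE S)
  (fun e eA => Aend e _ eA (or_introl erefl)) (fun e eA => Aend e _ eA (or_intror erefl)).
pose k := incl K.
have [x|e|f fE] := @morph_corestr _ A _ (incl S \om k).
- by rewrite inE; apply/orP; right; apply: imset_f; apply: (valP x).
- by case: (K0 e).
have fI : morph_inj f.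
  apply: (@morph_inj_cancel _ _ _ (incl A)); rewrite fE.
  by apply: morph_inj_comp; apply: incl_inj.
have poG : pushout f k (incl A) (incl S).
  apply: pushout_of_inter => //; [exact: incl_inj|exact: incl_inj|..].
  - move=> x y xy; have := valP x; rewrite !inE.
    have -> : val x \in subV S by rewrite [val x]xy; apply: valP.
    case/imsetP => z zP xz; have [z' z'z] := @sub_node _ K _ zP.
    apply/codomP; exists z'; apply: val_inj.
    by rewrite [RHS](congr1 (fun h => vmap h z') fE) /= z'z.
  - move=> x y xy; have := valP x; rewrite !inE.
    by have -> : val x \in subE S by rewrite [val x]xy; apply: valP.
  - move=> z; have [/sub_node|zS] := boolP (z \in subV S); first by left.
    by right; apply: (@sub_node _ A); rewrite !inE zS.
  - move=> z; have [/sub_edge|zS] := boolP (z \in subE S); first by left.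
    by right; apply: (@sub_edge _ A); rewrite !inE zS.
have [phi [phiI _ phir]] := pushout_unique (glue_pushout k fI) poG.
(* Equality of tracks gives each persistent node a single image in [M], so one morphism [km] serves
   both branches. *)
have /fin_all_exists[b bP] : forall x : V (graph_of_sub K), exists w : V M,
    [/\ derivation_track ds1 (track d1' [set vmap k x]) = [set w],
        derivation_track ds2 (track d2' [set vmap k x]) = [set w] & vlab w = vlab x].
  move=> x; have [tE t0] := joinP (vmap k x) (valP x).
  have [tr0|/track_neq0E[y yx trE]] := eqVneq (track d1' [set vmap k x]) set0.
    by rewrite tr0 derivation_track0 eqxx in t0.
  rewrite trE in t0; have [w [wE wl]] := derivation_track_point t0.
  exists w; rewrite -tE trE wE wl morph_vlab; split=> //.
  by rewrite -(morph_vlab k) -yx.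
have [km kmE] : exists km : morph (graph_of_sub K) M, vmap km = b.
  by apply: edgeless_morph K0 _ => x; have [] := bP x.
(* One branch, stated for either step: the first step is extended by [glue_step], the joining
   derivation by [glue_derivation]. *)
have side r H H' (d : direct_derivation r G H) (d' : direct_derivation r (graph_of_sub S) H')
    (ds : derivation rules H' M) :
    incl S \om dd_match d' = dd_match d ->
    (forall x : V (graph_of_sub K), track d' [set vmap k x] != set0) ->
    (forall x : V (graph_of_sub K), derivation_track ds (track d' [set vmap k x]) = [set b x]) ->
    inhabited (derivation rules H (glue f km)).
  move=> gE tr0 dsE.
  have [x|e|kc kcE] := @morph_corestr _ (context (dd_match d')) _ k.
  - exact: track_neq0 (tr0 x).
  - by case: (K0 e).
  have [d'' d''g] := glue_step fI kcE.
  have HE : isomorphic (glue f (dd_in' d' \om kc)) H.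
    by apply: (dd_unique (d := d'') (d' := d) phiI); rewrite d''g morph_comp_assoc phir.
  have [|ds'] := @glue_derivation _ _ _ _ _ ds f (dd_in' d' \om kc) km fI K0.
    by move=> x; rewrite kmE -dsE -(congr1 (fun h => vmap h x) kcE) track1.
  exact: derivation_transport (isomorphic_sym HE) ds'.
have Kper (x : V (graph_of_sub K)) : vmap k x \in persistent d1' d2' := valP x.
exists (glue f km); split.
  apply: (side _ _ _ d1 d1' ds1) => // x; last by have [] := bP x.
  by have := Kper x; rewrite inE => /andP[].
apply: (side _ _ _ d2 d2' ds2) => // x; last by have [] := bP x.
by have := Kper x; rewrite inE => /andP[].
Qed.

(** * Restriction of two steps to the union of their images *)

Lemma match_images_subgraph r1 r2 G (g1 : morph (lhs r1) G) (g2 : morph (lhs r2) G) :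
  exists S : subgraph G,
    subV S = vmap g1 @: setT :|: vmap g2 @: setT /\
    subE S = emap g1 @: setT :|: emap g2 @: setT.
Proof.
set Sv := vmap g1 @: setT :|: vmap g2 @: setT.
set Se := emap g1 @: setT :|: emap g2 @: setT.
have s e : e \in Se -> src e \in Sv.
  by case/setUP=> /imsetP[x _ ->]; rewrite morph_src inE imset_f ?orbT.
have t e : e \in Se -> tgt e \in Sv.
  by case/setUP=> /imsetP[x _ ->]; rewrite morph_tgt inE imset_f ?orbT.
by exists (Subgraph s t).
Qed.

Lemma incl_cover G (S : subgraph G) A1 A2 (g1 : morph A1 (graph_of_sub S))
    (g2 : morph A2 (graph_of_sub S)) :
  subV S = vmap (incl S \om g1) @: setT :|: vmap (incl S \om g2) @: setT ->
  subE S = emap (incl S \om g1) @: setT :|: emap (incl S \om g2) @: setT ->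
  vmap g1 @: setT :|: vmap g2 @: setT = setT /\
  emap g1 @: setT :|: emap g2 @: setT = setT.
Proof.
move=> SV SE; split; apply/setP => x; rewrite [RHS]inE; apply/setUP.
  have : vmap (incl S) x \in subV S by apply: valP.
  by rewrite SV => /setUP[]/imsetP[y _ /val_inj ->]; [left|right]; apply: imset_f.
have : emap (incl S) x \in subE S by apply: valP.
by rewrite SE => /setUP[]/imsetP[y _ /val_inj ->]; [left|right]; apply: imset_f.
Qed.

(** Used contrapositively: dependent steps remain dependent when restricted to [S]. *)
Lemma parallelly_independent_incl r1 r2 G H1 H2 H1' H2' (S : subgraph G)
    (d1 : direct_derivation r1 G H1) (d2 : direct_derivation r2 G H2)
    (d1' : direct_derivation r1 (graph_of_sub S) H1')
    (d2' : direct_derivation r2 (graph_of_sub S) H2') :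
  incl S \om dd_match d1' = dd_match d1 -> incl S \om dd_match d2' = dd_match d2 ->
  parallelly_independent d1' d2' -> parallelly_independent d1 d2.
Proof.
rewrite /parallelly_independent => <- <- [pV pE].
by split; [apply: imset_comp_interS pV|apply: imset_comp_interS pE];
  apply: val_inj.
Qed.

End Graphs.

Theorem mainTheorem16 (L : alphabet) (rules : seq (rule L))
    (D : graph_class L -> Prop) :
  (forall (G H1 H2 : graph L) (r1 r2 : rule L)
     (d1 : direct_derivation r1 G H1) (d2 : direct_derivation r2 G H2),
     List.In r1 rules -> List.In r2 rules ->
     critical_pair d1 d2 -> non_garbage D G ->
     strongly_joinable d1 d2 rules) ->
  locally_confluent_modulo_garbage rules D.
Proof.
move=> crit G GD H1 H2 r1 r2 r1R r2R d1 d2.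
have [ind|dep] := classic (parallelly_independent d1 d2).
  exact: parallelly_independent_joinable ind.
(* Critical pairs exclude equal matches of one rule; in that case the two results are isomorphic and
   [H2] joins them. *)
have [[r12 eqg]|neqg] := classic (exists r12 : r1 = r2,
    morph_eq (ecast r (morph (lhs r) G) r12 (match_morph (dd_match d1))) (dd_match d2)).
  case: r2 / r12 r2R d2 dep eqg => r2R d2 dep /= /morph_ext eqg.
  have idI (X : graph L) : morph_iso (morph_id X) by split; exists id.
  have [|f fI] := dd_unique (d := d1) (d' := d2) (idI G); first by rewrite morph_1comp.
  by exists H2; split; split; apply: DerivIso; [apply: fI|apply: idI].
have [S [SV SE]] := match_images_subgraph (dd_match d1) (dd_match d2).
have [x|x|g1 g1E] := @match_restrict _ _ _ (dd_match d1) S.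
- by rewrite SV inE imset_f.
- by rewrite SE inE imset_f.
have [x|x|g2 g2E] := @match_restrict _ _ _ (dd_match d2) S.
- by rewrite SV inE imset_f ?orbT.
- by rewrite SE inE imset_f ?orbT.
have [H1' [d1' [d1g _]]] := match_rewrite g1.
have [H2' [d2' [d2g _]]] := match_rewrite g2.
rewrite -d1g in g1E; rewrite -d2g in g2E.
apply: (strongly_joinable_lift g1E g2E); apply: crit => //.
  rewrite -g1E -g2E in SV SE; have [cV cE] := incl_cover SV SE.
  split=> // [/(parallelly_independent_incl g1E g2E)//|r12 eqg].
  apply: neqg; exists r12.
  (* Eliminating [r12] makes the cast compute; equal restricted matches then give equal matches in
     [G], against [neqg]. *)
  clear r2R dep SV SE cV cE; case: r2 / r12 d2 g2 d2' d2g g2E eqg => d2 g2 d2' _ g2E /= /morph_ext eqg.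
  by rewrite -g1E -g2E eqg.
(* The class of [G] is in [D], so every subgraph-closed superset of [D] contains the class of
   [S]. *)
by move=> D' D'sub DD'; apply: D'sub; apply: DD'.
Qed.
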